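(* Let $G_1$ and $G_2$ be two finite simple graphs with disjoint vertex sets, neither of which has a well-connected vertex. Then \[ C^\xi(G_1+G_2) = |E(G_1)| + |E(G_2)| + |V(G_1)|\,|V(G_2)|. \]
   Context: A vertex of a graph is well-connected if it is adjacent to all other vertices of the graph. The join $G_1+G_2$ of graphs with disjoint vertex sets $V_1,V_2$ and edge sets $E_1,E_2$ has vertex set $V_1\cup V_2$ and edge set $E_1\cup E_2\cup\{xy : x\in V_1, y\in V_2\}$. For a connected graph $H$, $d_H(v)$ is the degree of $v$, the eccentricity $\varepsilon_H(v)$ is the largest distance from $v$ to any other vertex, and the connective eccentric index is $C^\xi(H)=\sum_{v\in V(H)} \frac{d_H(v)}{\varepsilon_H(v)}$. *)

(* Defs.v *)
From mathcomp Require Import all_boot all_order all_algebra.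

Set Implicit Arguments.
Unset Strict Implicit.
Unset Printing Implicit Defensive.

Import Order.TTheory GRing.Theory Num.Theory.

Record sgraph := SGraph {
  vertex :> finType;
  adj : rel vertex;
  adj_sym : symmetric adj;
  adj_irrefl : irreflexive adj
}.
Arguments adj {s}.

Definition edges (G : sgraph) : {set {set G}} :=
  [set [set p.1; p.2] | p : G * G & adj p.1 p.2].

Definition degree (G : sgraph) (v : G) : nat := #|[set u | adj v u]|.

Definition well_connected (G : sgraph) (v : G) : Prop :=
  forall u : G, u != v -> adj v u.

Definition connected (G : sgraph) : Prop :=
  forall x y : G, connect adj x y.

Definition walk (G : sgraph) (n : nat) (x y : G) : bool :=
  [exists p : n.-tuple G, path adj x p && (last x p == y)].

(* Least length of a walk from [x] to [y]; a shortest walk has fewer than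
   #|G| edges, so the bounded search suffices. When [x] and [y] lie in
   different components the value is #|G|, which has no meaning. *)
Definition dist (G : sgraph) (x y : G) : nat :=
  find (fun n => walk n x y) (iota 0 #|G|).

Definition ecc (G : sgraph) (v : G) : nat := \max_(u : G | u != v) dist v u.

(* Meaningful for connected [G]. The eccentricity vanishes only on the
   one-vertex graph, where the degree is 0 as well. *)
Definition conn_ecc_index (G : sgraph) : rat :=
  (\sum_(v : G) (degree v)%:R / (ecc v)%:R)%R.

(* The sum type makes the two vertex sets disjoint. *)
Definition join_adj (G1 G2 : sgraph) : rel (G1 + G2)%type :=
  fun x y => match x, y with
  | inl a, inl b => adj a b
  | inr a, inr b => adj a b
  | _, _ => true
  end.

Lemma join_adj_sym (G1 G2 : sgraph) : symmetric (@join_adj G1 G2).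
Proof. by move=> [a|a] [b|b] //=; rewrite adj_sym. Qed.

Lemma join_adj_irrefl (G1 G2 : sgraph) : irreflexive (@join_adj G1 G2).
Proof. by move=> [a|a] /=; rewrite adj_irrefl. Qed.

Definition join (G1 G2 : sgraph) : sgraph :=
  SGraph (@join_adj_sym G1 G2) (@join_adj_irrefl G1 G2).

Lemma walkP (G : sgraph) (n : nat) (x y : G) :
  reflect (exists p, [/\ size p = n, path adj x p & last x p = y])
          (walk n x y).
Proof.
apply: (iffP existsP) => [[p /andP[xp /eqP py]]|[p [sp xp py]]].
  by exists p; rewrite size_tuple.
have sp' : size p == n by apply/eqP.
by exists (Tuple sp') => /=; rewrite xp py eqxx.
Qed.

Lemma dist_le (G : sgraph) (x y : G) (p : seq G) :
  path adj x p -> last x p = y -> dist x y <= size p.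
Proof.
move=> xp py; rewrite leqNgt; apply/negP => lt_pd.
have lt_pG : size p < #|G|.
  apply: leq_trans lt_pd _.
  by rewrite -[X in _ <= X](size_iota 0); exact: find_size.
have := before_find 0 lt_pd; rewrite nth_iota // add0n => /walkP[].
by exists p.
Qed.

Lemma dist_attained (G : sgraph) (x y : G) :
  connect adj x y -> walk (dist x y) x y.
Proof.
case/connectP=> p0 xp0 ->; case: (shortenP xp0) => p xp Up _.
have lt_pG : size p < #|G|.
  by rewrite -/(size (x :: p)) -(card_uniqP Up) max_card.
have h : has (fun n => walk n x (last x p)) (iota 0 #|G|).
  by apply/hasP; exists (size p); [rewrite mem_iota | apply/walkP; exists p].
have := nth_find 0 h; rewrite nth_iota ?add0n //.
by rewrite -[X in _ < X](size_iota 0) -has_find.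
Qed.

Lemma join_connected (G1 G2 : sgraph) :
  0 < #|G1| -> 0 < #|G2| -> connected (join G1 G2).
Proof.
move=> /card_gt0P[a _] /card_gt0P[b _] [x|x] [y|y]; last 1 first.
- by apply: (@connect_trans _ _ (inl a)); apply: connect1.
- by apply: (@connect_trans _ _ (inr b)); apply: connect1.
- exact: connect1.
- exact: connect1.
Qed.

(* Main.v *)
(** Without well-connected vertices, every vertex of the join has eccentricity
    exactly 2: a non-neighbour lies on the same side and is reached through any
    vertex of the other side. So the index is half the sum of the degrees,
    which the handshake lemma evaluates. *)
Require Import Defs.
From mathcomp Require Import all_boot all_order all_algebra.
From mathcomp Require Import ring.

Set Implicit Arguments.
Unset Strict Implicit.
Unset Printing Implicit Defensive.

Import GRing.Theory.

(** Double counting of ordered adjacent pairs: grouped by first vertex they give the degrees,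
    grouped by the edge they span they fall into classes of size two. *)
Lemma handshake (G : sgraph) : \sum_(v : G) degree v = 2 * #|edges G|.
Proof.
transitivity (\sum_(p in [set p : G * G | adj p.1 p.2]) 1).
  rewrite (eq_bigl (fun p : G * G => adj p.1 p.2)); last by move=> p; rewrite inE.
  rewrite -(pair_big_dep xpredT (fun v u : G => adj v u) (fun _ _ => 1)) /=.
  by apply: eq_bigr => v _; rewrite /degree sum1dep_card.
rewrite (partition_big_imset (fun p : G * G => [set p.1; p.2])) /=.
rewrite mulnC -sum_nat_const; apply: eq_bigr => e /imsetP[[a b]].
rewrite inE /= => ab ->.
have neq_ab : a != b by apply: contraTneq ab => ->; rewrite adj_irrefl.
(* The factor 2 becomes the size of the fibre over the edge [[set a; b]]: its two orientations,
   distinct because loops are excluded. *)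
have <- : #|[set (a, b); (b, a)]| = 2.
  by rewrite cards2 xpair_eqE (negPf neq_ab).
rewrite sum1dep_card; apply: eq_card => -[c d]; rewrite !inE /= !xpair_eqE.
apply/andP/orP => [[cd /eqP E] | ].
  have neq_cd : c != d by apply: contraTneq cd => ->; rewrite adj_irrefl.
  have c_ab : c \in [set a; b] by rewrite -E set21.
  have d_ab : d \in [set a; b] by rewrite -E set22.
  move: c_ab d_ab neq_cd; rewrite !inE => /orP[]/eqP-> /orP[]/eqP->;
    by rewrite ?eqxx; first [by [] | by left | by right].
case=> /andP[/eqP-> /eqP->]; first by [].
by rewrite adj_sym setUC.
Qed.

(** Connectedness makes [dist x y] the length of a genuine walk; length 0 would force [y = x], and
    length 1 adjacency. *)
Lemma dist_ge2 (G : sgraph) (x y : G) :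
  connect adj x y -> y != x -> ~~ adj x y -> 2 <= dist x y.
Proof.
move=> /dist_attained/walkP[p [<- xp py]] neq_yx nadj.
case: p xp py => [|a [|b p]] //=; first by move=> _ /esym/eqP; rewrite (negPf neq_yx).
by rewrite andbT => xa ay; rewrite -ay xa in nadj.
Qed.

Lemma ecc_eq2 (G : sgraph) (v : G) :
  ~ well_connected v ->
  (forall u, ~~ adj v u -> exists2 w, adj v w & adj w u) -> ecc v = 2.
Proof.
move=> nwc common; apply/eqP; rewrite eqn_leq; apply/andP; split.
  apply/bigmax_leqP => u _; case: (boolP (adj v u)) => [vu | /common[w vw wu]].
    by apply: leq_trans (dist_le (p := [:: u]) _ _) _; rewrite //= vu.
  by apply: (dist_le (p := [:: w; u])); rewrite //= vw wu.
(* Adjacency is boolean, so the failure of [well_connected v] yields an explicit non-neighbour,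
   whose distance from [v] attains the bound 2. *)
have /existsP[u /andP[neq_uv nvu]] : [exists u, (u != v) && ~~ adj v u].
  apply: contraT => /existsPn nex; case: nwc => u neq_uv.
  by have := nex u; rewrite neq_uv negbK.
have [w vw wu] := common u nvu.
apply: (@leq_trans (dist v u)); last first.
  exact: (leq_bigmax_cond (P := fun u => u != v)).
by apply: dist_ge2 => //; apply: connect_trans (connect1 vw) (connect1 wu).
Qed.

Section Join.
Variables G1 G2 : sgraph.

(** Well-connectedness of [inl a] in the join would restrict to [G1]. *)
Lemma ecc_join_inl (a : G1) :
  0 < #|G2| -> ~ well_connected a -> ecc (inl a : join G1 G2) = 2.
Proof.
move=> /card_gt0P[b _] nwc; apply: ecc_eq2 => [wc | [u|u]] //; last by exists (inr b).
by apply: nwc => u neq_ua; apply: (wc (inl u)).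
Qed.

Lemma ecc_join_inr (b : G2) :
  0 < #|G1| -> ~ well_connected b -> ecc (inr b : join G1 G2) = 2.
Proof.
move=> /card_gt0P[a _] nwc; apply: ecc_eq2 => [wc | [u|u]] //; last by exists (inl a).
by apply: nwc => u neq_ub; apply: (wc (inr u)).
Qed.

Lemma degree_join_inl (a : G1) :
  degree (inl a : join G1 G2) = degree a + #|G2|.
Proof.
by rewrite /degree -!sum1dep_card -sum1_card big_sumType.
Qed.

Lemma degree_join_inr (b : G2) :
  degree (inr b : join G1 G2) = #|G1| + degree b.
Proof.
by rewrite /degree -!sum1dep_card -sum1_card big_sumType.
Qed.

End Join.

Theorem theorem3 (G1 G2 : sgraph)
    (G1_nonempty : (0 < #|G1|)%N) (G2_nonempty : (0 < #|G2|)%N)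
    (G1_nwc : ~ (exists v : G1, well_connected v))
    (G2_nwc : ~ (exists v : G2, well_connected v)) :
  conn_ecc_index (join G1 G2) =
    (#|edges G1|%:R + #|edges G2|%:R + #|G1|%:R * #|G2|%:R)%R.
Proof.
have ecc2 (v : join G1 G2) : ecc v = 2.
  case: v => v.
    by apply: ecc_join_inl => // wc; apply: G1_nwc; exists v.
  by apply: ecc_join_inr => // wc; apply: G2_nwc; exists v.
rewrite /conn_ecc_index; under eq_bigr do rewrite ecc2.
rewrite -mulr_suml -natr_sum big_sumType /=.
under eq_bigr do rewrite degree_join_inl.
under [X in _ + X]eq_bigr do rewrite degree_join_inr.
(* Each side contributes one copy of [#|G1| * #|G2|], so the degree sum is twice the claimed value;
   the common eccentricity 2 cancels this factor. *)
rewrite !big_split /= !handshake !sum_nat_const !natrD !natrM.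
by field.
Qed.
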